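(* Let $\dots\to G_1\to G_0$ be an inverse sequence of countable groups and homomorphisms, and let $H_i\subset G_i$ be subgroups forming an inverse sequence under the restrictions of the bonding maps. If the induced map $\varprojlim^1 H_i\to\varprojlim^1 G_i$ is surjective, then the inverse sequence of the pointed sets of cosets $G_i/H_i$ satisfies the Mittag-Leffler condition.
   Context: For an inverse sequence $\dots\xrightarrow{p_1}G_1\xrightarrow{p_0}G_0$ of groups, the group $\prod_i G_i$ acts on the set $\prod_i G_i$ on the right by $(g_0,g_1,\dots)\cdot(x_0,x_1,\dots)=(x_0^{-1}g_0p_0(x_1),\,x_1^{-1}g_1p_1(x_2),\dots)$; the derived limit $\varprojlim^1 G_i$ is the set of orbits of this action, pointed by the orbit of $(1,1,\dots)$. An inverse sequence $\dots\to S_1\to S_0$ of sets satisfies the Mittag-Leffler condition if for each $i$ there exists a $j>i$ such that for each $k>j$ the image of $S_k\to S_i$ equals the image of $S_j\to S_i$. $G_i/H_i$ is the set of cosets $gH_i$ (equivalently, via inversion, of cosets $H_ig$), with the induced bonding maps. *)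

(* Defs.v *)
From HB Require Import structures.
From mathcomp Require Import all_boot monoid.
From mathcomp Require Import boolp classical_sets functions cardinality.

Set Implicit Arguments.
Unset Strict Implicit.
Unset Printing Implicit Defensive.

Local Open Scope group_scope.
Local Open Scope quotient_scope.
Local Open Scope classical_set_scope.

(* The homomorphisms are the morphisms of monoids between groups. *)
Notation group_hom := UMagmaMorphism.type.

Section InverseSequenceOfSets.
Variables (S : nat -> Type) (p : forall i, S i.+1 -> S i).

Fixpoint bond (i n : nat) : S (n + i) -> S i :=
  match n return S (n + i) -> S i with
  | 0 => id
  | n'.+1 => fun x => bond (p x)
  end.

(* The indices j > i and k > j are written as m + i with 0 < m and n + i with *)
(* m < n, so that the type of [bond] computes without casts.                  *)
Definition mittag_leffler : Prop :=
  forall i, exists2 m, 0 < m &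
    forall n, m < n -> range (@bond i n) = range (@bond i m).

End InverseSequenceOfSets.

Section DerivedLimit.
Variables (G : nat -> groupType) (p : forall i, group_hom (G i.+1) (G i)).

Definition lim1_act (g x : forall i, G i) : forall i, G i :=
  fun i => (x i)^-1 * g i * p i (x i.+1).

Lemma lim1_act1 g : lim1_act g (fun=> 1) = g.
Proof.
apply: functional_extensionality_dep => i.
by rewrite /lim1_act gmulf1 invg1 mul1g mulg1.
Qed.

Lemma lim1_actM g x y :
  lim1_act g (fun i => x i * y i) = lim1_act (lim1_act g x) y.
Proof.
apply: functional_extensionality_dep => i.
by rewrite /lim1_act gmulfM invgM !mulgA.
Qed.

Definition same_orbit : rel (forall i, G i) :=
  fun g h => `[< exists x, lim1_act g x = h >].

Lemma same_orbit_refl : reflexive same_orbit.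
Proof. by move=> g; apply/asboolP; exists (fun=> 1); rewrite lim1_act1. Qed.

Lemma same_orbit_sym : symmetric same_orbit.
Proof.
suff H g h : same_orbit g h -> same_orbit h g.
  by move=> g h; apply/idP/idP; apply: H.
move=> /asboolP[x <-]; apply/asboolP; exists (fun i => (x i)^-1).
rewrite -lim1_actM -[RHS]lim1_act1; congr lim1_act.
by apply: functional_extensionality_dep => i; rewrite mulgV.
Qed.

Lemma same_orbit_trans : transitive same_orbit.
Proof.
move=> h g k /asboolP[x <-] /asboolP[y <-]; apply/asboolP.
by exists (fun i => x i * y i); rewrite lim1_actM.
Qed.

Canonical same_orbit_equiv :=
  EquivRel same_orbit same_orbit_refl same_orbit_sym same_orbit_trans.

Definition lim1 := {eq_quot same_orbit}.

HB.instance Definition _ := Choice.on lim1.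
HB.instance Definition _ := EqQuotient.on lim1.
HB.instance Definition _ :=
  isPointed.Build lim1 (\pi_lim1 (fun i => 1 : G i)).

End DerivedLimit.

Section InducedMap.
Variables (G K : nat -> groupType).
Variables (p : forall i, group_hom (G i.+1) (G i)).
Variables (q : forall i, group_hom (K i.+1) (K i)).
Variable f : forall i, group_hom (G i) (K i).

(* [fE] below makes this independent of the representative: [lim1_map_pi].   *)
Definition lim1_map (c : lim1 p) : lim1 q :=
  \pi_(lim1 q) (fun i => f i (repr c i)).

Hypothesis fE : forall i x, f i (p i x) = q i (f i.+1 x).

Lemma lim1_map_pi (g : forall i, G i) :
  lim1_map (\pi_(lim1 p) g) = \pi_(lim1 q) (fun i => f i (g i)).
Proof.
apply/eqP; rewrite eqmodE.
have : repr (\pi_(lim1 p) g) = g %[mod lim1 p] by rewrite reprK.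
move=> /eqP; rewrite eqmodE => /asboolP[x xE].
apply/asboolP; exists (fun i => f i (x i)).
apply: functional_extensionality_dep => i.
rewrite -[in RHS]xE /lim1_act !gmulfM fE; congr (_ * _ * _).
by apply: (mulgI (f i (x i))); rewrite mulgV -gmulfM mulgV gmulf1.
Qed.

End InducedMap.

Arguments lim1_map {G K p q} f c.

(* Membership in a subgroup is a boolean predicate; in the classical logic of *)
(* boolp this covers every subgroup.                                          *)
Section Subgroup.
Variables (G : groupType) (H : groupClosed G).

Definition subgroup := {x : G | x \in H}.

HB.instance Definition _ := SubChoice.on subgroup.

Fact subgroup_closed : group_closed H.
Proof. by split; [exact: gpred1 | move=> x y; exact: gpredF]. Qed.

HB.instance Definition _ :=
  SubChoice_isSubGroup.Build G _ subgroup subgroup_closed.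

Definition subgroup_incl : subgroup -> G := val.

HB.instance Definition _ := UMagmaMorphism.on subgroup_incl.

Definition same_lcoset : rel G := fun x y => x^-1 * y \in H.

Lemma same_lcoset_refl : reflexive same_lcoset.
Proof. by move=> x; rewrite /same_lcoset mulVg gpred1. Qed.

Lemma same_lcoset_sym : symmetric same_lcoset.
Proof. by move=> x y; rewrite /same_lcoset -gpredV invgM invgK. Qed.

Lemma same_lcoset_trans : transitive same_lcoset.
Proof.
move=> y x z xy yz; rewrite /same_lcoset.
by rewrite -[z](mulVKg y) mulgA gpredM.
Qed.

Canonical same_lcoset_equiv :=
  EquivRel same_lcoset same_lcoset_refl same_lcoset_sym same_lcoset_trans.

Definition lcosets := {eq_quot same_lcoset}.

HB.instance Definition _ := Choice.on lcosets.
HB.instance Definition _ := EqQuotient.on lcosets.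
HB.instance Definition _ := isPointed.Build lcosets (\pi_lcosets 1).

End Subgroup.

Section InverseSequenceOfSubgroups.
Variables (G : nat -> groupType) (p : forall i, group_hom (G i.+1) (G i)).
Variable H : forall i, groupClosed (G i).
Hypothesis pH : forall i x, x \in H i.+1 -> p i x \in H i.

Definition subgroup_bond i (x : subgroup (H i.+1)) : subgroup (H i) :=
  Sub (p i (val x)) (pH (valP x)).

Fact subgroup_bond_morphism i : monoid_morphism (@subgroup_bond i).
Proof.
split=> [|x y]; apply: val_inj.
  by rewrite /= gmulf1.
by rewrite /= gmulfM.
Qed.

HB.instance Definition _ i :=
  isUMagmaMorphism.Build _ _ (@subgroup_bond i)
    (@subgroup_bond_morphism i).

Definition lim1_subgroup : Type :=
  lim1 (G := fun i => subgroup (H i)) (fun i => @subgroup_bond i).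

HB.instance Definition _ := Pointed.on lim1_subgroup.
HB.instance Definition _ := EqQuotient.on lim1_subgroup.

Definition lim1_incl : lim1_subgroup -> lim1 p :=
  lim1_map (G := fun i => subgroup (H i)) (K := G)
    (fun i => @subgroup_incl _ (H i)).

Lemma lim1_incl_pi (h : forall i, subgroup (H i)) :
  lim1_incl (\pi_lim1_subgroup h) = \pi_(lim1 p) (fun i => val (h i)).
Proof. by apply: lim1_map_pi => i x. Qed.

Definition lcosets_bond i (c : lcosets (H i.+1)) : lcosets (H i) :=
  \pi_(lcosets (H i)) (p i (repr c)).

Lemma lcosets_bond_pi i (g : G i.+1) :
  lcosets_bond (\pi_(lcosets (H i.+1)) g) = \pi_(lcosets (H i)) (p i g).
Proof.
apply/eqP; rewrite eqmodE.
have : repr (\pi_(lcosets (H i.+1)) g) = g %[mod lcosets (H i.+1)].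
  by rewrite reprK.
move=> /eqP; rewrite eqmodE /= /same_lcoset => /pH; rewrite gmulfM.
set r := repr _ => prg; suff -> : (p i r)^-1 = p i r^-1 by [].
by apply: (mulgI (p i r)); rewrite mulgV -gmulfM mulgV gmulf1.
Qed.

End InverseSequenceOfSubgroups.

Arguments lim1_incl {G p H} pH c.
Arguments lcosets_bond {G} p H i c.

(* Main.v *)
(* Surjectivity on lim^1 says that twisting the bonding maps of the cosets    *)
(* [G i / H i] by left translations by arbitrary [g i] never makes their      *)
(* inverse limit empty. If the images of [G (n + i) / H (n + i)] in           *)
(* [G i / H i] do not stabilize, then, each of them being homogeneous under   *)
(* the image of [G (n + i)], one can choose [g] inductively so that the       *)
(* twisted images successively miss every element of the countable set        *)
(* [G i / H i], and the twisted limit is empty.                               *)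
Require Import Defs.
From mathcomp Require Import all_boot monoid.
From mathcomp Require Import boolp classical_sets functions cardinality.
Local Open Scope classical_set_scope.

Local Open Scope group_scope.
Local Open Scope quotient_scope.

(** If the condition fails at [i], [not_mittag_leffler_at] gives stages [N k] along which the image
    of the cosets in level [i] shrinks strictly. By [avoid_coset], a factor inserted at stage [N k]
    keeps the coset of [s k] out of the twisted image of stage [N k.+1], where [s] enumerates [G i].
    Yet [twisted_limit_image] yields one [x] whose coset lies in all twisted images, and [x] is some
    [s k]. *)

Lemma countable_enum (T : Type) (x0 : T) :
  countable [set: T] -> exists s : nat -> T, forall x, exists k, s k = x.
Proof.
move=> /countable_injP[f f_inj].
have /choice[s sP] : forall k, exists y, forall x, f x = k -> x = y.
  move=> k; have [[x xk]|nx] := pselect (exists x, f x = k).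
    by exists x => y yk; apply: f_inj; rewrite ?in_setE // xk.
  by exists x0 => x xk; case: nx; exists x.
by exists s => x; exists (f x); rewrite -(sP _ x).
Qed.

Lemma extend_shifted_family (G : nat -> Type) (x0 : forall j, G j) (i : nat)
    (g : forall n, G (n + i)) :
  exists g' : forall j, G j, forall n, g' (n + i) = g n.
Proof.
(* Quantifying over [e] avoids choosing a transport: [n] is determined by [j], and indices below [i]
   get [x0]. *)
have ext j : exists y : G j,
    forall n (e : (n + i)%N = j), y = ecast k (G k) e (g n).
  have [[n e]|nij] := pselect (exists n, (n + i)%N = j); last first.
    by exists (x0 j) => n e; case: nij; exists n.
  case: j / e; exists (g n) => m e.
  have mn := addIn e; case: n / mn e => e.
  by rewrite eq_axiomK.
exists (fun j => sval (cid (ext j))) => n.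
exact: (svalP (cid (ext (n + i)%N)) n erefl).
Qed.

Section GroupSequence.
Variables (G : nat -> groupType) (p : forall i, group_hom (G i.+1) (G i)).

Definition gbond (i n : nat) : G (n + i) -> G i := bond (fun j => p j) (n := n).

Lemma gbondM i n (x y : G (n + i)) :
  gbond i n (x * y) = gbond i n x * gbond i n y.
Proof. by rewrite /gbond; elim: n x y => //= n IH x y; rewrite gmulfM IH. Qed.

Lemma gbond1 i n : gbond i n 1 = 1.
Proof. by rewrite /gbond; elim: n => //= n IH; rewrite gmulf1. Qed.

Lemma gbondV i n (x : G (n + i)) : gbond i n x^-1 = (gbond i n x)^-1.
Proof. by apply: (mulgI (gbond i n x)); rewrite -gbondM !mulgV gbond1. Qed.

Lemma gbond_factor {i n m} (w : G (m + i)) :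
  (n <= m)%N -> exists v, gbond i m w = gbond i n v.
Proof.
elim: m w => [|m IH] w; first by rewrite leqn0 => /eqP->; exists w.
rewrite leq_eqVlt => /orP[/eqP->|/IH]; first by exists w.
exact.
Qed.

Variable H : forall i, groupClosed (G i).
Hypothesis pH : forall i (x : G i.+1), x \in H i.+1 -> p i x \in H i.

Lemma gbond_subgroup i n (x : G (n + i)) :
  x \in H (n + i) -> gbond i n x \in H i.
Proof. by rewrite /gbond; elim: n x => //= n IH x /pH/IH. Qed.

Lemma bond_lcosets_pi i n (x : G (n + i)) :
  bond (lcosets_bond p H) (\pi_(lcosets (H (n + i))) x) =
  \pi_(lcosets (H i)) (gbond i n x).
Proof.
by rewrite /gbond; elim: n x => //= n IH x; rewrite lcosets_bond_pi // IH.
Qed.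

Lemma range_bond_lcosets i n (x : G i) :
  range (bond (lcosets_bond p H) (n := n)) (\pi_(lcosets (H i)) x) <->
  exists y, x^-1 * gbond i n y \in H i.
Proof.
split=> [[c _]|[y xy]].
  rewrite -[c]reprK bond_lcosets_pi => /esym/eqP.
  by rewrite eqmodE => xy; exists (repr c).
exists (\pi_(lcosets (H (n + i))) y) => //.
by rewrite bond_lcosets_pi; apply/esym/eqP; rewrite eqmodE.
Qed.

(** The images decrease with the stage, so two of them differ only if some coset, that of
    [gbond i m z], is lost. *)
Lemma not_mittag_leffler_at i :
  ~ (exists2 m, (0 < m)%N & forall n, (m < n)%N ->
       range (@bond _ (lcosets_bond p H) i n) =
       range (@bond _ (lcosets_bond p H) i m)) ->
  forall m, (0 < m)%N -> exists n, (m < n)%N /\ exists z : G (m + i),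
    forall w : G (n + i), (gbond i m z)^-1 * gbond i n w \notin H i.
Proof.
move=> nML m m0; apply: contrapT => nstep; apply: nML; exists m => // n mn.
apply/seteqP; split=> c; rewrite -[c]reprK => /range_bond_lcosets[w xw].
  have [v wv] := gbond_factor w (ltnW mn).
  by apply/range_bond_lcosets; exists v; rewrite -wv.
apply: contrapT => cn; apply: nstep; exists n; split=> //; exists w => v.
apply/negP => wv; apply/cn/range_bond_lcosets; exists v.
by rewrite -[gbond i n v](mulVKg (gbond i m w)) mulgA gpredM.
Qed.

Lemma avoid_coset {i m n} (mn : (m < n)%N) (z : G (m + i)) :
  (forall w : G (n + i), (gbond i m z)^-1 * gbond i n w \notin H i) ->
  forall a : G i, exists y : G (m + i), forall w : G (n + i),
    a * gbond i m y * gbond i n w \notin H i.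
Proof.
move=> zP a; have [[u au]|nu] :=
    pselect (exists u : G (m + i), a * gbond i m u \in H i).
  (* This translation moves the lost coset of [z] onto the coset of [a^-1]: the factor
     [a * gbond i m u] lies in [H i] and cancels. *)
  exists (u * z^-1) => w; apply: contra (zP w).
  rewrite gbondM gbondV !mulgA -[_ * _^-1 * gbond i n w]mulgA.
  by rewrite gpredMl.
(* Here the coset of [a^-1] is already outside the larger image of stage [m]. *)
exists 1 => w; apply/negP; have [v ->] := gbond_factor w (ltnW mn).
by rewrite gbond1 mulg1 => av; apply: nu; exists v.
Qed.

Hypothesis lim1_surj : set_surj [set: _] [set: _] (lim1_incl (p := p) pH).

(** An [x] carrying [g] into the subgroups represents a thread of cosets for the bonding maps
    twisted by [g]. *)
Lemma twisted_limit_nonempty (g : forall j, G j) :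
  exists x : forall j, G j, forall j, (x j)^-1 * g j * p j (x j.+1) \in H j.
Proof.
have [c _] := lim1_surj (\pi_(lim1 p) g) I.
rewrite -[c]reprK lim1_incl_pi => /esym/eqP.
rewrite eqmodE => /asboolP[x xE]; exists x => j.
by move/(congr1 (fun f => f j)): xE; rewrite /lim1_act => ->; apply: valP.
Qed.

(* The product [g i * p (g (1 + i)) * ... * p^(n-1) (g (n - 1 + i))], when    *)
(* each factor may depend on the product of the previous ones.                *)
Fixpoint twist {i} (F : forall n, G i -> G (n + i)) (n : nat) : G i :=
  if n is m.+1 then twist F m * gbond i m (F m (twist F m)) else 1.

Lemma twistS {i} (F : forall n, G i -> G (n + i)) n :
  twist F n.+1 = twist F n * gbond i n (F n (twist F n)).
Proof. by []. Qed.

Lemma twisted_limit_image {i} (F : forall n, G i -> G (n + i)) :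
  exists x : G i, forall n, exists w, x^-1 * twist F n * gbond i n w \in H i.
Proof.
have [g gE] := @extend_shifted_family G (fun=> 1) i (fun n => F n (twist F n)).
have [x xP] := twisted_limit_nonempty g.
exists (x i) => n; exists (x (n + i)%N).
elim: n => [|n IH] /=; first by rewrite mulg1 mulVg gpred1.
have /gbond_subgroup := xP (n + i)%N; rewrite !gbondM gbondV gE => xn.
(* The product telescopes: the image of [x (n + i)] cancels. *)
by have := gpredM _ _ IH xn; rewrite !mulgA mulgK.
Qed.

End GroupSequence.

Theorem lemma3p7
  (G : nat -> groupType) (p : forall i, group_hom (G i.+1) (G i))
  (countableG : forall i, countable [set: G i])
  (H : forall i, groupClosed (G i))
  (pH : forall i (x : G i.+1), x \in H i.+1 -> p i x \in H i)
  (lim1_surj : set_surj [set: _] [set: _] (lim1_incl pH)) :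
  mittag_leffler (lcosets_bond p H).
Proof.
move=> i; apply: contrapT => /(not_mittag_leffler_at _ _ _ pH) step.
have [s sP] := countable_enum _ 1 (countableG i).
have /choice[next nextP] : forall m, exists n, (0 < m)%N ->
    (m < n)%N /\ exists z : G (m + i)%N,
    forall w : G (n + i)%N, (gbond _ p i m z)^-1 * gbond _ p i n w \notin H i.
  by case=> [|m]; [exists 0|have [n] := step m.+1 isT; exists n].
(* Starting at 1 keeps every stage positive, as [nextP] requires. *)
pose N k := iter k next 1%N.
have N_gt0 k : (0 < N k)%N.
  by elim: k => // k IH; have [/(leq_ltn_trans _)->] := nextP _ IH.
have N_ltS k : (N k < N k.+1)%N by have [] := nextP _ (N_gt0 k).
have N_mono : {homo N : k l / (k < l)%N} := homo_ltn ltn_trans N_ltS.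
(* At stage [N k], the coset of [s k] is removed from the image of stage      *)
(* [N k.+1]; at all other stages there is no twist.                           *)
pose good n a (y : G (n + i)%N) :=
  (forall k, N k = n -> forall w : G (N k.+1 + i)%N,
     (s k)^-1 * a * gbond _ p i n y * gbond _ p i (N k.+1) w \notin H i) /\
  ((forall k, N k <> n) -> y = 1).
have goodP n a : exists y, good n a y.
  have [[k kn]|nk] := pselect (exists k, N k = n); last first.
    by exists 1; split=> // k kn; case: nk; exists k.
  have [z zP] := (nextP _ (N_gt0 k)).2.
  have [y yP] := avoid_coset G p H (N_ltS k) z zP ((s k)^-1 * a).
  case: n / kn; exists y; split=> [l lk|/(_ k)//].
  suff -> : l = k by [].
  by case: (ltngtP l k) => // /N_mono; rewrite lk ltnn.
pose F n a := sval (cid (goodP n a)).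
have FP n a : good n a (F n a) := svalP (cid (goodP n a)).
(* No [N l] lies strictly between [N k] and [N k.+1], so the factors there are 1. *)
have twist_const k d : (N k + d < N k.+1)%N ->
    twist G p F (N k + d).+1 = twist G p F (N k).+1.
  elim: d => [|d IH]; rewrite ?addn0 // addnS => dk.
  rewrite -(IH (ltnW dk)) twistS.
  rewrite (FP _ _).2 ?gbond1 ?mulg1 // => l lE.
  have : (N k < N l < N k.+1)%N by rewrite lE dk ltnS leq_addr.
  case: (ltngtP l k) => [/N_mono|kl|->]; last by rewrite ltnn.
  - by move=> lk /andP[/ltn_trans/(_ lk)]; rewrite ltnn.
  - move: kl; rewrite leq_eqVlt => /orP[/eqP<-|/N_mono lk /andP[_]].
      by rewrite ltnn andbF.
    by move=> /ltn_trans/(_ lk); rewrite ltnn.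
have [x xP] := twisted_limit_image G p H pH lim1_surj F.
have [k kx] := sP x.
have [w] := xP (N k.+1); apply/negP.
have twistN : twist G p F (N k.+1) = twist G p F (N k).+1.
  by rewrite -(twist_const k (N k.+1 - (N k).+1)%N) -addSn subnKC.
rewrite twistN -kx twistS mulgA.
exact: (FP _ _).1.
Qed.
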